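(* Let $p\in\mathbb Z$ and $q\in\mathbb N^*$ be relatively prime and let $\gamma=2\pi p/q$. For all $(\theta_1,\theta_2)\in\mathbb R^2$ and all $\lambda$, $$P_G(\theta_1,\theta_2,\lambda)=(-1)^q\,\det\big(M_T(\theta_1,\theta_2,0)+3I_q-\lambda^2 I_q\big),$$ where $P_G(\theta_1,\theta_2,\lambda)=\det(M_G(\theta_1,\theta_2)-\lambda I_{2q})$ is the characteristic polynomial of the graphene matrix $M_G$, and $M_T(\theta_1,\theta_2,0)$ is the triangular Harper matrix with $\phi=0$.
   Context: Let $p\in\mathbb Z$, $q\in\mathbb N^*$ be relatively prime and $\gamma=2\pi p/q$. The $q\times q$ matrices $J_{p,q}$ and $K_q$ are $J_{p,q}=\mathrm{diag}(e^{i(j-1)\gamma})_{j=1,\dots,q}$ and $(K_q)_{jk}=1$ if $k\equiv j+1 \pmod q$, $(K_q)_{jk}=0$ otherwise. $I_n$ is the $n\times n$ identity matrix and ${}^*$ denotes the adjoint. Graphene (hexagonal) matrix, of size $2q\times 2q$: $$M_G(\theta_1,\theta_2)=\begin{pmatrix}0& I_q+e^{i\theta_1}J_{p,q}+e^{i\theta_2}K_q\\ I_q+e^{-i\theta_1}J_{p,q}^*+e^{-i\theta_2}K_q^*&0\end{pmatrix}.$$ Triangular Harper matrix, of size $q\times q$: $$M_T(\theta_1,\theta_2,\phi)=e^{i\theta_1}J_{p,q}+e^{-i\theta_1}J_{p,q}^*+e^{i\theta_2}K_q+e^{-i\theta_2}K_q^*+e^{i\phi}e^{i(\theta_1-\theta_2)}J_{p,q}K_q^*+e^{-i\phi}e^{i(\theta_2-\theta_1)}K_qJ_{p,q}^*.$$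 *)

(* Defs.v *)
From mathcomp Require Import all_boot all_order all_algebra.
From mathcomp Require Import reals trigo.
From mathcomp Require Import complex.

Set Implicit Arguments.
Unset Strict Implicit.
Unset Printing Implicit Defensive.

Import Order.TTheory GRing.Theory Num.Theory.

Local Open Scope ring_scope.
Local Open Scope sesquilinear_scope.

Section Matrices.
Variable R : realType.

(* e^{it} for real t *)
Definition expi (t : R) : R[i] := (cos t +i* sin t)%C.

Section PQ.
Variables (p : int) (q : nat).

Definition flux : R := 2 * pi * p%:~R / q%:R.

(* Rows and columns are numbered from 0, so the j-th diagonal entry
   e^{i(j-1)gamma} of the 1-based convention is e^{ij gamma} here. *)
Definition Jmx : 'M[R[i]]_q := diag_mx (\row_(j < q) expi (j%:R * flux)).

Definition Kmx : 'M[R[i]]_q :=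
  \matrix_(j < q, k < q) (if k == j.+1 %[mod q] then 1 else 0).

Definition graphene_mx (theta1 theta2 : R) : 'M[R[i]]_(q + q) :=
  block_mx
    0
    (1%:M + expi theta1 *: Jmx + expi theta2 *: Kmx)
    (1%:M + expi (- theta1) *: Jmx ^t* + expi (- theta2) *: Kmx ^t*)
    0.

Definition triangular_mx (theta1 theta2 phi : R) : 'M[R[i]]_q :=
  expi theta1 *: Jmx + expi (- theta1) *: Jmx ^t*
  + expi theta2 *: Kmx + expi (- theta2) *: Kmx ^t*
  + (expi phi * expi (theta1 - theta2)) *: (Jmx *m Kmx ^t*)
  + (expi (- phi) * expi (theta2 - theta1)) *: (Kmx *m Jmx ^t*).

(* The sign convention is det(M - lambda), not mathcomp's
   char_poly = det(X - M); both agree here as q + q is even. *)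
Definition graphene_charpoly (theta1 theta2 : R) (lambda : R[i]) : R[i] :=
  \det (graphene_mx theta1 theta2 - lambda%:M).

End PQ.
End Matrices.

(* Main.v *)
Require Import Defs.
From mathcomp Require Import all_boot all_order all_algebra.
From mathcomp Require Import reals trigo.
From mathcomp Require Import complex.
Import Order.TTheory GRing.Theory Num.Theory.
Local Open Scope ring_scope.

(** The graphene matrix is bipartite: it is off-diagonal with blocks [A] and
    its adjoint [A'], where [A = 1 + e^{i theta1} J + e^{i theta2} K].  The determinant of
    such a matrix minus [lambda] reduces to a determinant of half the size,
    [det (lambda^2 - A A')] ([det_block_scalar_diag]), so only [A A'] has to
    be identified.  Its nine products are three squares, each equal to [1]
    because [J] and [K] are unitary ([Jmx_unitary], [Kmx_unitary]), which is
    the shift by [3], and six cross terms, which are exactly the six terms of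
    the triangular matrix at [phi = 0].  The sign [(-1)^q] comes from replacing
    [lambda^2 - A A'] by its opposite, of size [q]. *)

Local Open Scope sesquilinear_scope.

(** Multiplying the block matrix on the right by the block lower triangular
    matrix with rows [(x, 0)] and [(- C, 1)] clears the lower left block, at
    the price of a factor [x ^+ n] in the determinant, which regularity
    cancels. *)
Lemma det_block_scalar_diag_reg {S : comNzRingType} {n : nat} {x : S}
    (A C : 'M[S]_n) :
  GRing.lreg x ->
  \det (block_mx x%:M A C x%:M) = \det ((x ^+ 2)%:M - A *m C).
Proof.
move=> regx; have := congr1 determinant
  (mulmx_block x%:M A C x%:M x%:M 0 (- C) 1%:M).
rewrite !mulmx0 !mulmx1 !add0r det_mulmx det_lblock !det_scalar expr1n mulr1.
have -> : C *m x%:M + x%:M *m - C = 0.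
  by rewrite mulmxN scalar_mxC subrr.
rewrite det_ublock det_scalar -scalar_mxM mulmxN -expr2.
by rewrite mulrC [RHS]mulrC; apply: lregX.
Qed.

(** A general [x], possibly zero, is a specialization of the indeterminate,
    which is regular. *)
Lemma det_block_scalar_diag {S : comNzRingType} {n : nat} (x : S)
    (A C : 'M[S]_n) :
  \det (block_mx x%:M A C x%:M) = \det ((x ^+ 2)%:M - A *m C).
Proof.
have regX : GRing.lreg ('X : {poly S}) by apply/monic_lreg/monicX.
have := congr1 (horner_eval x)
  (det_block_scalar_diag_reg (map_mx polyC A) (map_mx polyC C) regX).
rewrite -!det_map_mx map_block_mx map_mxB map_mxM !map_scalar_mx rmorphXn /=.
have evalC (B : 'M[S]_n) : map_mx (horner_eval x) (map_mx polyC B) = B.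
  by apply/matrixP => i j; rewrite !mxE /horner_eval hornerC.
by rewrite !evalC /horner_eval hornerX.
Qed.

Section Unitarity.
Variable R : realType.

Lemma expi0 : expi (0 : R) = 1.
Proof. by rewrite /expi cos0 sin0. Qed.

Lemma expiD (s t : R) : expi (s + t) = expi s * expi t.
Proof.
by rewrite /expi cosD sinD; apply/eqP; rewrite eq_complex /= eqxx addrC eqxx.
Qed.

Lemma expiN (t : R) : expi (- t) = (expi t)^*.
Proof. by rewrite /expi cosN sinN. Qed.

Lemma expi_mulN (t : R) : expi t * expi (- t) = 1.
Proof. by rewrite -expiD subrr expi0. Qed.

Lemma Jmx_unitary (p : int) (q : nat) : Jmx R p q *m (Jmx R p q)^t* = 1%:M.
Proof.
rewrite /Jmx tr_diag_mx map_diag_mx mulmx_diag -diag_const_mx.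
by congr diag_mx; apply/rowP => j; rewrite !mxE /= -expiN expi_mulN.
Qed.

(** Each row of [K] has a single entry [1], and the rows are distinct because
    the cyclic successor [ordS] is injective. *)
Lemma Kmx_unitary (q : nat) : Kmx R q *m (Kmx R q)^t* = 1%:M.
Proof.
have KE (j k : 'I_q) : Kmx R q j k = (k == ordS j)%:R.
  by rewrite mxE -val_eqE /= modn_small //; case: eqP.
apply/matrixP => j l; rewrite mxE [RHS]mxE (bigD1 (ordS j)) //=.
rewrite big1 => [|k /negPf nk].
  by rewrite KE eqxx mul1r addr0 2!mxE KE (inj_eq (@ordS_inj q)) rmorph_nat.
by rewrite KE nk mul0r.
Qed.

End Unitarity.

Lemma hexagonal_block_product (R : realType) (p : int) (q : nat)
    (theta1 theta2 : R) :
  (1%:M + expi theta1 *: Jmx R p q + expi theta2 *: Kmx R q) *m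
  (1%:M + expi (- theta1) *: (Jmx R p q)^t* + expi (- theta2) *: (Kmx R q)^t*)
  = triangular_mx p q theta1 theta2 0 + 3%:M.
Proof.
rewrite /triangular_mx oppr0 expi0 !mul1r !expiD.
rewrite !mulmxDl !mulmxDr !mul1mx !mulmx1 -!scalemxAl -!scalemxAr !scalerA.
rewrite Jmx_unitary Kmx_unitary !expi_mulN !scale1r.
have -> : 3%:M = 1%:M + (1%:M + 1%:M) :> 'M[R[i]]_q.
  by rewrite -2!raddfD.
by rewrite [LHS](AC (3*3*3) (4*2*7*3*6*8*(1*(5*9)))).
Qed.

Theorem theorem1p1 (R : realType) (p : int) (q : nat) (q_gt0 : (0 < q)%N)
    (coprime_pq : coprimez p q%:Z) (theta1 theta2 : R) (lambda : R[i]) :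
  graphene_charpoly p q theta1 theta2 lambda =
  (-1) ^+ q * \det (triangular_mx p q theta1 theta2 0 + 3%:M
                    - (lambda ^+ 2)%:M).
Proof.
rewrite /graphene_charpoly /graphene_mx (scalar_mx_block q q lambda).
rewrite opp_block_mx add_block_mx !add0r !oppr0 !addr0.
have -> : - lambda%:M = (- lambda)%:M :> 'M_q by rewrite raddfN.
rewrite det_block_scalar_diag hexagonal_block_product sqrrN.
by rewrite -detZ scaleN1r opprB.
Qed.
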